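(* Let $n,k\in\mathbb{N}$, let $\mathbf{a}^{1},\dots,\mathbf{a}^{k}\in\mathbb{R}^{n}$ be pairwise linearly independent vectors, and let $f\in C(\mathbb{R}^{n})$ be a function of the form $$f(\mathbf{x})=\sum_{i=1}^{k}f_{i}(\mathbf{a}^{i}\cdot\mathbf{x}),\qquad \mathbf{x}\in\mathbb{R}^{n},$$ where $f_{1},\dots,f_{k}:\mathbb{R}\to\mathbb{R}$ are arbitrary functions (no regularity assumed). Suppose there is a nonsingular linear transformation $T:\mathbb{R}^{n}\to\mathbb{R}^{n}$ such that $T\mathbf{a}^{i}\in\mathbb{Q}^{n}$ for $i=1,\dots,k$. Then there exist continuous functions $g_{i}:\mathbb{R}\to\mathbb{R}$, $i=1,\dots,k$, such that $$f(\mathbf{x})=\sum_{i=1}^{k}g_{i}(\mathbf{a}^{i}\cdot\mathbf{x})\qquad\text{for all }\mathbf{x}\in\mathbb{R}^{n}.$$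
   Context: All functions are real-valued. $\mathbf{a}\cdot\mathbf{x}$ denotes the standard inner product on $\mathbb{R}^{n}$, and $C(\mathbb{R}^{n})$ is the class of continuous functions on $\mathbb{R}^{n}$. *)

(* Defs.v *)
From HB Require Import structures.
From mathcomp Require Import all_boot all_order all_algebra.
From mathcomp Require Import all_classical all_reals all_analysis.

Set Implicit Arguments.
Unset Strict Implicit.
Unset Printing Implicit Defensive.

Import Order.TTheory GRing.Theory Num.Theory.
Import numFieldNormedType.Exports.

Local Open Scope ring_scope.

(* Points of R^n are row vectors; 'rV[R]_n carries the product topology for
   every n, including n = 0. *)
Definition dotv (R : realType) (n : nat) (u v : 'rV[R]_n) : R :=
  \sum_(j < n) u 0 j * v 0 j.

Definition pairwise_independent (R : realType) (n k : nat)
    (a : 'I_k -> 'rV[R]_n) : Prop :=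
  forall i j : 'I_k, i != j -> free [:: a i; a j].

Definition rational_vector (R : realType) (n : nat) (v : 'rV[R]_n) : Prop :=
  forall j : 'I_n, exists q : rat, v 0 j = ratr q.

(* Main.v *)
(** Restrict each f_i to the rationals. Iterated differences of f along vectors
    v_j orthogonal to a^j with a^i . v_j = 1 annihilate every other summand, so
    the (k-1)-fold differences of f_i on Q are bounded and uniformly small on
    bounded sets, because f is continuous. Both properties descend from
    (m+1)-fold to m-fold differences: the difference in a step x is additive in
    x up to an error that is a difference of the next order, and an almost
    additive function on Q is close to a linear one. Hence f_i is uniformly
    continuous on bounded subsets of Q and extends to a continuous g_i on R. The
    identity with the g_i holds wherever all a^i . x are rational, and the
    rationality of the T a^i makes this set dense. *)

Require Import Defs.
From HB Require Import structures.
From mathcomp Require Import all_boot all_order all_algebra.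
From mathcomp Require Import all_classical all_reals all_analysis.
From mathcomp Require Import ring lra zify.

Set Implicit Arguments.
Unset Strict Implicit.
Unset Printing Implicit Defensive.

Import Order.TTheory GRing.Theory Num.Theory.
Import numFieldNormedType.Exports.

Local Open Scope ring_scope.

(** * Iterated differences on abelian groups *)

Definition diff1 (U V : zmodType) (h : U) (phi : U -> V) : U -> V :=
  fun t => phi (t + h) - phi t.

Definition diffs (U V : zmodType) (hs : seq U) (phi : U -> V) : U -> V :=
  foldr (@diff1 U V) phi hs.

Lemma diff1C (U V : zmodType) (h h' : U) (phi : U -> V) t :
  diff1 h (diff1 h' phi) t = diff1 h' (diff1 h phi) t.
Proof.
rewrite /diff1 (addrAC t h h') !opprB addrACA [RHS]addrACA.
by congr (_ + _); rewrite addrC.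
Qed.

Lemma eq_diff1 (U V : zmodType) (h : U) (phi psi : U -> V) :
  phi =1 psi -> diff1 h phi =1 diff1 h psi.
Proof. by move=> e t; rewrite /diff1 !e. Qed.

Lemma diffs_diff1 (U V : zmodType) (hs : seq U) (h : U) (phi : U -> V) t :
  diffs hs (diff1 h phi) t = diff1 h (diffs hs phi) t.
Proof.
elim: hs t => [//|x hs IH] t /=.
by rewrite (eq_diff1 x IH) diff1C.
Qed.

Lemma eq_diffs (U V : zmodType) (hs : seq U) (phi psi : U -> V) :
  phi =1 psi -> diffs hs phi =1 diffs hs psi.
Proof. by move=> e; elim: hs => [//|x hs IH]; apply: eq_diff1. Qed.

Lemma diffs0 (U V : zmodType) (hs : seq U) (phi : U -> V) t :
  0 \in hs -> diffs hs phi t = 0.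
Proof.
elim: hs t => [//|x hs IH] t; rewrite inE => /orP[/eqP <-|h0] /=.
  by rewrite /diff1 addr0 subrr.
by rewrite /diff1 !IH // subrr.
Qed.

Lemma diffs_comp (U U' V : zmodType) (g : U -> U') (hs : seq U)
    (phi : U' -> V) t :
  {morph g : x y / x + y >-> x + y} ->
  diffs hs (phi \o g) t = diffs (map g hs) phi (g t).
Proof.
by move=> gD; elim: hs t => [//|x hs IH] t /=; rewrite /diff1 !IH gD.
Qed.

Lemma diffs_sum (U V : zmodType) (I : finType) (hs : seq U)
    (phi : I -> U -> V) t :
  diffs hs (fun s => \sum_i phi i s) t = \sum_i diffs hs (phi i) t.
Proof.
by elim: hs t => [//|x hs IH] t /=; rewrite /diff1 !IH -sumrB.
Qed.

(** * Almost additive functions on the rationals *)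

Section QuasiAdditive.
Variables (R : realType).

(* The maximum M over the lattice satisfies M <= (M + 3C)/2: doubling a point of
   modulus at most L/2 nearly doubles beta, and any other point is moved into
   that range by a shift by L, which changes beta by at most C. *)
Lemma lattice_bound (beta : rat -> R) (L : rat) (C : R) (q : nat) :
  0 < L -> 0 <= C -> (0 < q)%N -> beta L = 0 ->
  (forall x y, `|x| <= L -> `|y| <= L -> `|x + y| <= L ->
     `|beta (x + y) - beta x - beta y| <= C) ->
  forall p : int, `|p| <= q%:Z -> `|beta (p%:~R * (L / q%:R))| <= C *+ 3.
Proof.
move=> L0 C0 q0 bL qa.
pose s := L / q%:R.
have sq : q%:R * s = L by rewrite /s mulrC divfK // pnatr_eq0 -lt0n.
have s0 : 0 < s by rewrite divr_gt0 // ltr0n.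
have inL (p : int) : (`|p%:~R * s| <= L) = (`|p| <= q%:Z).
  rewrite normrM (gtr0_norm s0) -sq ler_pM2r // -intr_norm.
  by rewrite -[q%:R]/(q%:Z%:~R) ler_int.
(* The shift by [q] turns the indices [0..2q] into the integers of modulus at most [q]. *)
pose M : R := \big[Num.max/0]_(i < (q + q).+1) `|beta ((i%:Z - q%:Z)%:~R * s)|.
have leM (p : int) : `|p| <= q%:Z -> `|beta (p%:~R * s)| <= M.
  move=> hp; have hi : (absz (p + q%:Z)%R < (q + q).+1)%N by lia.
  rewrite /M; apply: le_trans (le_bigmax _ _ (Ordinal hi)) => /=.
  have -> : Posz (absz (p + q%:Z)%R) - q%:Z = p by lia.
  exact: lexx.
have M0 : 0 <= M by exact: le_trans (leM 0 _).
have half (p : int) : `|p + p| <= q%:Z -> `|beta (p%:~R * s)| *+ 2 <= M + C.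
  clearbody M; move=> hp; have hp' : `|p| <= q%:Z by lia.
  have := qa (p%:~R * s) (p%:~R * s); rewrite -mulrDl -intrD !inL.
  move=> /(_ hp' hp' hp); have := leM _ hp.
  move: (beta _) (beta _) => v u; rewrite !ler_norml => /andP[h1 h2] /andP[h3 h4].
  by have [h|h] := ler0P v; lra.
have shift (p r : int) : `|p| <= q%:Z -> `|r| <= q%:Z -> p = r + q%:Z ->
    `|beta (p%:~R * s) - beta (r%:~R * s)| <= C.
  move=> hp hr e; have := qa (r%:~R * s) (q%:Z%:~R * s).
  rewrite -mulrDl -intrD -e !inL (sq : q%:Z%:~R * s = L) bL subr0.
  by apply=> //; rewrite ger0_norm.
have imp (p : int) : `|p| <= q%:Z -> `|beta (p%:~R * s)| *+ 2 <= M + C *+ 3.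
  clearbody M; move=> hp.
  have [h1|] := boolP (`|p + p| <= q%:Z); first by have := half _ h1; lra.
  (* Here [|p| > q/2]; moving [p] by [q] towards zero leaves modulus [q - |p| < q/2]. *)
  move=> h1; have [r [hr hrr]] : exists r : int, [/\ `|r| <= q%:Z, `|r + r| <= q%:Z &
      (p == r + q%:Z) || (r == p + q%:Z)].
    have [p0|p0] := leP 0 p; first by exists (p - q%:Z); split; lia.
    by exists (p + q%:Z); split; lia.
  move=> e.
  have d : `|beta (p%:~R * s) - beta (r%:~R * s)| <= C.
    by case/orP: e => /eqP e; [exact: shift|rewrite distrC; exact: shift].
  have := half _ hrr.
  have := ler_normD (beta (p%:~R * s) - beta (r%:~R * s)) (beta (r%:~R * s)).
  by rewrite subrK; lra.
have MC : M <= (M + C *+ 3) / 2.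
  apply: bigmax_le => [|i _]; first by lra.
  have hi : `|i%:Z - q%:Z| <= q%:Z by have := ltn_ord i; lia.
  by have := imp _ hi; lra.
by move=> p hp; apply: le_trans (leM _ hp) _; lra.
Qed.

(** Subtracting the linear function with value [alpha L] at [L] makes the lattice bound applicable.
    That bound does not depend on the mesh, and every rational [x] lies on the lattice of mesh
    [L / q], where [q] is the denominator of [x / L]. *)
Lemma quasi_additive_bound (alpha : rat -> R) (L : rat) (C : R) :
  0 < L -> 0 <= C ->
  (forall x y, `|x| <= L -> `|y| <= L -> `|x + y| <= L ->
     `|alpha (x + y) - alpha x - alpha y| <= C) ->
  forall x, `|x| <= L -> `|alpha x| <= `|alpha L| + C *+ 3.
Proof.
move=> L0 C0 qa x xL.
pose beta y := alpha y - ratr (y / L) * alpha L.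
have bL : beta L = 0 by rewrite /beta divff ?gt_eqF // rmorph1 mul1r subrr.
have qb y z : `|y| <= L -> `|z| <= L -> `|y + z| <= L ->
    `|beta (y + z) - beta y - beta z| <= C.
  move=> hy hz hyz; have := qa y z hy hz hyz; congr (`|_| <= _).
  by rewrite /beta mulrDl rmorphD /=; ring.
pose w := x / L.
have q0 : (0 < `|denq w|)%N by rewrite absz_gt0 denq_neq0.
have dE : `|denq w|%N%:Z = denq w by rewrite gez0_abs.
have := @lattice_bound beta L C `|denq w|%N L0 C0 q0 bL qb (numq w).
have w1 : `|w| <= 1 by rewrite /w normrM normfV (gtr0_norm L0) ler_pdivrMr // mul1r.
have hw : `|numq w| <= `|denq w|%N%:Z.
  rewrite dE -(ler_int rat) intr_norm; move: w1; rewrite -{1}(divq_num_den w).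
  by rewrite normrM normfV (gtr0_norm (_ : 0 < (denq w)%:~R)) ?ler_pdivrMr ?mul1r // ltr0z.
move=> /(_ hw).
have -> : (numq w)%:~R * (L / `|denq w|%N%:R) = x.
  rewrite -[`|denq w|%N%:R]/((`|denq w|%N%:Z)%:~R) dE mulrCA divq_num_den /w.
  by rewrite mulrC divfK // gt_eqF.
rewrite /beta -/w => h.
have h2 : `|ratr w * alpha L| <= `|alpha L|.
  rewrite normrM ler_piMl // -ratr_norm -(rmorph1 (@ratr R)) ler_rat //.
by have := ler_normD (alpha x - ratr w * alpha L) (ratr w * alpha L); rewrite subrK; lra.
Qed.

End QuasiAdditive.

(** * Lowering the order of differences on the rationals *)

Section RationalDifferences.
Variables (R : realType).
Implicit Types (phi : rat -> R) (L : rat).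

Definition bounded_diffs (m : nat) phi := forall L, 0 < L -> exists2 C : R, 0 <= C &
  forall hs t, size hs = m -> all (fun h => `|h| <= L) hs -> `|t| <= L ->
    `|diffs hs phi t| <= C.

(* Here m counts the steps other than the small one, so [small_diffs 0] is
   uniform continuity on bounded sets. *)
Definition small_diffs (m : nat) phi := forall L (eps : R), 0 < L -> 0 < eps ->
  exists2 delta : rat, 0 < delta &
  forall hs x t, size hs = m -> all (fun h => `|h| <= L) hs -> `|x| <= delta ->
    `|t| <= L -> `|diff1 x (diffs hs phi) t| <= eps.

(** With the other steps and the base point fixed, the difference is an almost additive function of
    its first step, so it is controlled by its value at the step [L]. That value is a lower-order
    difference of [diff1 L phi], bounded by induction. *)
Lemma bounded_diffsS m phi : bounded_diffs m.+1 phi -> bounded_diffs m phi.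
Proof.
elim: m phi => [|m IH] phi bphi L L0.
  have [C C0 hC] := bphi L L0; exists (`|phi 0| + C); first by rewrite addr_ge0.
  move=> [|//] t _ _ tL /=.
  have := hC [:: t] 0 erefl; rewrite /= tL normr0 ltW // /diff1 add0r => /(_ isT isT).
  by have := ler_normD (phi t - phi 0) (phi 0); rewrite subrK; lra.
have [C C0 hC] := bphi L L0.
have bL : bounded_diffs m (diff1 L phi).
  apply: IH => L' L'0.
  have [C' C'0 hC'] := bphi (Num.max L L') ltac:(by rewrite lt_max L0).
  exists C' => // hs t shs ahs tL.
  rewrite diffs_diff1; apply: (hC' (L :: hs)) => /=; first by rewrite shs.
    rewrite gtr0_norm // le_max lexx /=.
    by apply: sub_all ahs => h hL; rewrite le_max hL orbT.
  by rewrite le_max tL orbT.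
have [C1 C10 hC1] := bL L L0.
exists (C1 + C *+ 3); first by rewrite addr_ge0 // mulrn_wge0.
move=> [//|x hs] t [shs] /= /andP[xL ahs] tL.
have := hC1 hs t shs ahs tL; rewrite diffs_diff1 => h1.
have := @quasi_additive_bound R (fun x => diff1 x (diffs hs phi) t) L C L0 C0.
suff qa y z : `|y| <= L -> `|z| <= L ->
  `|diff1 (y + z) (diffs hs phi) t - diff1 y (diffs hs phi) t
     - diff1 z (diffs hs phi) t| <= C.
  by move=> /(_ (fun y z hy hz _ => qa y z hy hz) x xL); lra.
(* The additivity defect is exactly the difference with the two steps [y] and [z]. *)
move=> hy hz; have := hC [:: y, z & hs] t; rewrite /= shs hy hz ahs.
move=> /(_ erefl isT tL); congr (`|_| <= _).
by rewrite /diff1 !addrA; ring.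
Qed.

(* Comparing the step n x with n steps x bounds the difference in the step x by
   C/n plus a small error. *)
Lemma small_diffsS m phi :
  bounded_diffs m.+1 phi -> small_diffs m.+1 phi -> small_diffs m phi.
Proof.
move=> bphi sphi L eps L0 eps0.
have [C C0 hC] := bphi L L0.
have e2 : 0 < eps / 2 by rewrite divr_gt0.
have [d d0 hd] := sphi L _ L0 e2.
(* This makes [C / n] at most [eps / 2]; the other half of [eps] pays for the additivity errors. *)
pose n := (Num.truncn (C / (eps / 2))).+1.
have hn : C <= eps / 2 * n%:R.
  by rewrite mulrC -ler_pdivrMr // ltW // truncnS_gt.
have n0 : 0 < n%:R :> R by rewrite ltr0n.
(* The bound [L / n] keeps all multiples of [x] up to [n] within the allowed steps. *)
exists (Num.min d (L / n%:R)); first by rewrite lt_min d0 divr_gt0 // ltr0n.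
move=> hs x t shs ahs; rewrite le_min => /andP[xd xL] tL.
have xjL j : (j <= n)%N -> `|x *+ j| <= L.
  move=> jn; rewrite normrMn.
  apply: (@le_trans _ _ ((L / n%:R) *+ j)); first by rewrite lerMn2r xL orbT.
  by rewrite -mulr_natr mulrAC ler_pdivrMr ?ltr0n // ler_pM2l // ler_nat.
set psi := diffs hs phi.
have step j : (j <= n)%N ->
    `|diff1 (x *+ j) psi t - (diff1 x psi t) *+ j| <= (eps / 2) *+ j.
  elim: j => [|j IHj] jn; first by rewrite /diff1 !mulr0n addr0 !subr0 subrr normr0.
  have := IHj (ltnW jn); have := hd (x *+ j :: hs) x t.
  rewrite /= shs ahs (xjL j (ltnW jn)) => /(_ erefl isT xd tL) /=.
  rewrite !mulrSr -/psi => h1 h2.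
  have -> : diff1 (x *+ j + x) psi t - (diff1 x psi t *+ j + diff1 x psi t) =
     diff1 x (diff1 (x *+ j) psi) t + (diff1 (x *+ j) psi t - diff1 x psi t *+ j).
    by rewrite /diff1 (addrAC t x) addrA; ring.
  by have := ler_normD (diff1 x (diff1 (x *+ j) psi) t)
    (diff1 (x *+ j) psi t - diff1 x psi t *+ j); lra.
have := step n (leqnn _).
have := hC (x *+ n :: hs) t; rewrite /= shs (xjL n) // ahs => /(_ erefl isT tL).
rewrite -/psi => h1 h2.
have h3 : `|diff1 x psi t| *+ n <= C + (eps / 2) *+ n.
  rewrite -normrMn.
  have := ler_normB (diff1 (x *+ n) psi t) (diff1 (x *+ n) psi t - diff1 x psi t *+ n).
  by rewrite opprB addrC subrK; lra.
rewrite -(ler_pM2r n0) mulr_natr (le_trans h3) // -[_ *+ n]mulr_natr; lra.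
Qed.

Lemma uniform_continuity_of_diffs m phi :
  bounded_diffs m phi -> small_diffs m phi -> small_diffs 0 phi.
Proof.
elim: m => [//|m IH] b s; apply: IH; first exact: bounded_diffsS.
exact: small_diffsS.
Qed.

End RationalDifferences.

(** * Differences of a continuous function on bounded sets *)

Section ContinuousDifferences.
Local Open Scope classical_set_scope.
Variables (R : realType) (n : nat) (f : 'rV[R]_n -> R).
Hypothesis cf : continuous f.

Let compact_ball (L : R) : compact [set y : 'rV[R]_n | `|y| <= L].
Proof.
apply: bounded_closed_compact.
  by exists L; split => [|M LM y]; [exact: num_real|move=> /= yL; apply: le_trans yL (ltW LM)].
rewrite (_ : [set y | _] = closed_ball_ Num.norm 0 L); first exact: closed_closed_ball_.
by rewrite /closed_ball_; apply/seteqP; split => y /=; rewrite sub0r normrN.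
Qed.

Lemma continuous_diffs_bounded (m : nat) (L : R) : exists2 C : R, 0 <= C &
  forall hs y, size hs = m -> all (fun h => `|h| <= L) hs -> `|y| <= L ->
    `|diffs hs f y| <= C.
Proof.
elim: m L => [|m IH] L.
  have [C [_ hC]] := @compact_bounded R R^o _
    (continuous_compact (continuous_subspaceT cf) (@compact_ball L)).
  exists (`|C| + 1); first by rewrite addr_ge0.
  case=> [|//] y _ _ yL /=; apply: (hC (`|C| + 1)); last by exists y.
  by rewrite (le_lt_trans (ler_norm _)) // ltrDl.
(* The outer difference also evaluates at [y + h], which is only known to lie in the ball of radius
   [L + L]. *)
have [C C0 hC] := IH (L + L); exists (C + C); first by rewrite addr_ge0.
move=> [//|h hs] y [shs] /= /andP[hL ahs] yL.
have L0 : 0 <= L := le_trans (normr_ge0 _) yL.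
have ahs' : all (fun h => `|h| <= L + L) hs.
  by apply: sub_all ahs => z zL; rewrite (le_trans zL) // lerDl.
have h1 := hC hs y shs ahs'; have h2 := hC hs (y + h) shs ahs'.
apply: le_trans (ler_normB _ _) (lerD _ _).
  by apply: h2; apply: le_trans (ler_normD _ _) (lerD _ _).
by apply: h1; rewrite (le_trans yL) // lerDl.
Qed.

(** Compactness in its near-covering form merges the local estimates around each [y] into one
    neighbourhood of [w = 0]. *)
Let uniformly_continuous (L eps : R) : 0 < eps -> exists2 delta : R, 0 < delta &
  forall w y, `|w| <= delta -> `|y| <= L -> `|diff1 w f y| <= eps.
Proof.
move=> e0.
have /compact_near_coveringP cov := compact_ball (L := L).
have /nbhs_closedballP[r hr] : nbhs (0 : 'rV[R]_n)
    (fun w => [set y | `|y| <= L] `<=` (fun y => `|diff1 w f y| < eps)).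
  apply: (cov _ (nbhs (0 : 'rV[R]_n)) (fun w y => `|diff1 w f y| < eps)) => y _.
  have e20 : 0 < eps / 2 by rewrite divr_gt0.
  have := @cvgrPdist_lt R R^o _ _ (nbhs_filter y) f (f y).
  case=> /(_ (@cf y)) /(_ _ e20) cfy _.
  have [A [Ay hA]] : exists A : set 'rV[R]_n,
      nbhs y A /\ forall z, A z -> `|f y - f z| < eps / 2.
    by exists (fun z => `|f y - f z| < eps / 2).
  have cD : p.1 + p.2 @[p --> (y, 0 : 'rV[R]_n)] --> y + 0.
    by apply: (@cvgD R 'rV[R]_n); [exact: cvg_fst|exact: cvg_snd].
  rewrite addr0 in cD; have [[B1 B2] /= [hB1 hB2] hB] := cD _ Ay.
  exists (A `&` B1, B2) => /=; first by split=> //; apply: filterI.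
  move=> [z w] /= [[Az B1z] B2w].
  have Azw : A (z + w) by apply: (hB (z, w)).
  rewrite /diff1; have := hA _ Az; have := hA _ Azw.
  rewrite !ltr_norml => /andP[? ?] /andP[? ?]; apply/andP; lra.
exists r%:num => // w y wr yL; apply/ltW; apply: (hr w) => //=.
by rewrite closed_ballE // /closed_ball_ /= sub0r normrN.
Qed.

Lemma continuous_diffs_small (m : nat) (L eps : R) : 0 < eps ->
  exists2 delta : R, 0 < delta &
  forall hs w y, size hs = m -> all (fun h => `|h| <= L) hs -> `|w| <= delta ->
    `|y| <= L -> `|diff1 w (diffs hs f) y| <= eps.
Proof.
elim: m L eps => [|m IH] L eps e0.
  have [d d0 hd] := uniformly_continuous L e0.
  by exists d => // -[|//] w y _ _; apply: hd.
have e20 : 0 < eps / 2 by rewrite divr_gt0.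
have [d d0 hd] := IH (L + L) _ e20; exists d => // -[//|h hs] w y [shs] /= /andP[hL ahs] wd yL.
have L0 : 0 <= L := le_trans (normr_ge0 _) yL.
have ahs' : all (fun h => `|h| <= L + L) hs.
  by apply: sub_all ahs => z zL; rewrite (le_trans zL) // lerDl.
rewrite diff1C [eps]splitr.
apply: le_trans (ler_normB _ _) (lerD _ _); apply: hd => //.
  by apply: le_trans (ler_normD _ _) (lerD _ _).
by rewrite (le_trans yL) // lerDl.
Qed.

End ContinuousDifferences.

(** * Inner products and differences of ridge sums *)

Lemma dotvD (R : realType) (n : nat) (a : 'rV[R]_n) :
  {morph dotv a : x y / x + y >-> x + y}.
Proof.
by move=> x y; rewrite /dotv -big_split; apply: eq_bigr => j _; rewrite mxE mulrDr.
Qed.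

Lemma dotvZ (R : realType) (n : nat) (a : 'rV[R]_n) c x :
  dotv a (c *: x) = c * dotv a x.
Proof.
by rewrite /dotv mulr_sumr; apply: eq_bigr => j _; rewrite mxE mulrCA.
Qed.

Lemma dotv_delta (R : realType) (n : nat) (a : 'rV[R]_n) j :
  dotv a (delta_mx 0 j) = a 0 j.
Proof.
rewrite /dotv (bigD1 j) //= big1 => [|l lj]; rewrite mxE !eqxx ?mulr1 ?addr0 //.
by rewrite (negbTE lj) mulr0.
Qed.

Section RidgeSum.
Variables (R : realType) (n k : nat) (a : 'I_k -> 'rV[R]_n).
Variables (f : 'rV[R]_n -> R) (fs : 'I_k -> R -> R).
Hypothesis hfs : forall x : 'rV[R]_n, f x = \sum_(i < k) fs i (dotv (a i) x).
Variables (i : 'I_k) (u : 'rV[R]_n) (w : 'I_k -> 'rV[R]_n).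
Hypothesis hu : dotv (a i) u = 1.
Hypothesis hwi : forall j, j != i -> dotv (a i) (w j) = 1.
Hypothesis hwj : forall j, j != i -> dotv (a j) (w j) = 0.

Let ws := [seq w j | j <- enum (predC1 i)].
Let steps (hs : seq rat) := [seq ratr p.1 *: p.2 | p <- zip hs ws].
Let phi (t : rat) := fs i (ratr t).

(** The [j]-th summand sees a zero step along [w j], so it is annihilated. The [i]-th summand sees
    exactly the steps [hs], because every direction in [ws] has product 1 with [a i]. *)
Let diffs_ridge hs t y : size hs = size ws -> dotv (a i) y = ratr t ->
  diffs hs phi t = diffs (steps hs) f y.
Proof.
move=> shs ay.
rewrite (eq_diffs _ hfs) diffs_sum (bigD1 i) //= big1 ?addr0 => [|j ji].
  rewrite (diffs_comp _ (fs i) _ (dotvD (a i))) ay.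
  rewrite (diffs_comp _ (fs i)); last by move=> x z; rewrite rmorphD.
  congr (diffs _ _ _); rewrite -{1}(unzip1_zip (eq_leq shs)) /unzip1 -!map_comp.
  apply/eq_in_map => p /(map_f snd); rewrite -/(unzip2 _) unzip2_zip ?shs //.
  case/mapP => j; rewrite mem_enum => ji /= ->; rewrite dotvZ hwi ?mulr1 //.
rewrite (diffs_comp _ (fs j) _ (dotvD (a j))) diffs0 //.
have : w j \in unzip2 (zip hs ws).
  by rewrite unzip2_zip ?shs //; apply: map_f; rewrite mem_enum.
case/mapP => p hp e; apply/mapP; exists (ratr p.1 *: p.2); first exact: map_f.
by rewrite dotvZ -e hwj // mulr0.
Qed.

(** A crude common bound for the norms of [u] and all [w j]: rational data of size [L] lift to
    vectors of norm at most [L * W]. *)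
Let W := `|u| + \sum_j `|w j|.

Let norm_stepsP (L : rat) hs : 0 < L -> all (fun h => `|h| <= L) hs ->
  all (fun h => `|h| <= ratr L * W) (steps hs).
Proof.
move=> L0 /allP ahs; apply/allP => _ /mapP[p hp ->].
have hp1 : p.1 \in hs.
  have := map_f fst hp; rewrite -/(unzip1 _).
  elim: (hs) (ws) => [|x s IH] [|y s'] //=; rewrite !inE => /orP[->//|/IH->].
  by rewrite orbT.
have [j ->] : exists j, p.2 = w j.
  have : p.2 \in ws.
    have := map_f snd hp; rewrite -/(unzip2 _).
    elim: (hs) (ws) => [|x s IH] [|y s'] //=; rewrite !inE => /orP[->//|/IH->].
    by rewrite orbT.
  by case/mapP => j _ ->; exists j.
rewrite normrZ ler_pM ?normr_ge0 //.
  by rewrite -ratr_norm ler_rat ahs.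
rewrite /W (bigD1 j) //= addrCA lerDl addr_ge0 // sumr_ge0 //.
Qed.

Let norm_u (L t : rat) : `|t| <= L -> `|ratr t *: u| <= ratr L * W.
Proof.
move=> tL; rewrite normrZ ler_pM ?normr_ge0 //; first by rewrite -ratr_norm ler_rat.
by rewrite /W lerDl sumr_ge0.
Qed.

Let dotv_u t : dotv (a i) (ratr t *: u) = ratr t.
Proof. by rewrite dotvZ hu mulr1. Qed.

Let size_steps hs : size hs = size ws -> size (steps hs) = size ws.
Proof. by move=> e; rewrite size_map size_zip e minnn. Qed.

(** Lifting [t] to [t *: u] and each step to a multiple of some [w j] transfers both difference
    estimates from [f] to [phi]; descending to order zero then concludes. *)
Lemma ridge_uniform_continuity : continuous f -> small_diffs 0 phi.
Proof.
move=> cf; apply: (@uniform_continuity_of_diffs _ (size ws)).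
  move=> L L0; have [C C0 hC] := continuous_diffs_bounded cf (size ws) (ratr L * W).
  exists C => // hs t shs ahs tL; rewrite (diffs_ridge shs (dotv_u t)).
  by apply: hC; [exact: size_steps|exact: norm_stepsP|exact: norm_u].
move=> L eps L0 e0.
have [d d0 hd] := continuous_diffs_small cf (size ws) (ratr L * W) e0.
have W0 : 0 <= W by rewrite addr_ge0 // sumr_ge0.
(* Adding 1 makes the denominator positive from [0 <= W] alone. *)
have : 0 < d / (W + 1) by rewrite divr_gt0 // ltr_wpDl.
move=> /rat_in_itvoo[q]; rewrite in_itv /= => /andP[q0 qd].
exists q; first by rewrite -(ltr_rat R) rmorph0.
move=> hs x t shs ahs xq tL.
have -> : diff1 x (diffs hs phi) t =
    diff1 (ratr x *: u) (diffs (steps hs) f) (ratr t *: u).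
  by rewrite /diff1 -scalerDl -rmorphD -!(diffs_ridge shs (dotv_u _)).
apply: hd; [exact: size_steps|exact: norm_stepsP| |exact: norm_u].
apply: le_trans (norm_u xq) _.
move: qd; rewrite ltr_pdivlMr ?ltr_wpDl // => /ltW; apply: le_trans.
by rewrite ler_pM2l // lerDl.
Qed.

End RidgeSum.

(** * Continuous extension from the rationals to the reals *)

Lemma rat_near (R : realType) (x eps : R) : 0 < eps ->
  exists q : rat, `|ratr q - x| < eps.
Proof.
move=> e0; have /rat_in_itvoo[q] : x - eps < x + eps by lra.
rewrite in_itv /= => /andP[h1 h2]; exists q; rewrite ltr_distl; lra.
Qed.

Lemma small_diffs_cauchy (R : realType) (phi : rat -> R) (x eps : R) :
  small_diffs 0 phi -> 0 < eps -> exists2 delta : R, 0 < delta &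
  forall p q : rat, `|ratr p - x| < delta -> `|ratr q - x| < delta ->
    `|phi p - phi q| <= eps.
Proof.
move=> sphi e0.
(* [L] exceeds [|x| + 1], hence bounds every rational within distance 1 of [x]. *)
pose L : rat := (Num.truncn `|x|).+2%:R.
have [d d0 hd] := sphi L eps (ltr0Sn _ _) e0.
have rd0 : 0 < ratr d :> R by rewrite ltr0q.
exists (Num.min 1 (ratr d / 2)); first by rewrite lt_min ltr01 divr_gt0.
move=> p q; rewrite !lt_min => /andP[p1 p2] /andP[q1 q2].
have := hd [::] (p - q) q erefl isT; rewrite /= /diff1 subrKC; apply.
  rewrite -(ler_rat R) ratr_norm rmorphB /=.
  by have := ler_distD x (ratr p) (ratr q); rewrite (distrC x); lra.
rewrite -(ler_rat R) ratr_norm /L ratr_nat -natr1.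
have := truncnS_gt `|x|; have := ler_normD (ratr q - x) x; rewrite subrK; lra.
Qed.

(** The Cauchy estimate gives [phi] a limit [g x] along rationals at every real [x]. Values [g x]
    and [g y] are compared through a rational near [y]; at a rational point the limit is [phi]
    itself, since the punctured and full neighbourhoods are not distinguished. *)
Lemma small_diffs_extension (R : realType) (phi : rat -> R) :
  small_diffs 0 phi ->
  exists2 g : R -> R, continuous g & forall q, g (ratr q) = phi q.
Proof.
move=> sphi.
have lim x : exists y : R, forall eps, 0 < eps -> exists2 delta : R, 0 < delta &
    forall q : rat, `|ratr q - x| < delta -> `|phi q - y| <= eps.
  (* The lower limit of phi at x. *)
  pose S := [set z : R | exists2 d : R, 0 < d &
    forall q : rat, `|ratr q - x| < d -> z <= phi q]%classic.
  exists (sup S) => eps e0.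
  have [d d0 hd] := small_diffs_cauchy x sphi e0; exists d => // q qx.
  have Sq : S (phi q - eps).
    by exists d => // p px; have := hd p q px qx; rewrite ler_norml => /andP[]; lra.
  have ubS : ubound S (phi q + eps).
    move=> z [d' d'0 hz]; have [p] : exists p : rat, `|ratr p - x| < Num.min d d'.
      by apply: rat_near; rewrite lt_min d0.
    rewrite lt_min => /andP[pd pd'].
    by have := hz p pd'; have := hd p q pd qx; rewrite ler_norml => /andP[]; lra.
  have h1 : phi q - eps <= sup S by apply: ub_le_sup => //; exists (phi q + eps).
  have h2 : sup S <= phi q + eps by apply: ge_sup => //; exists (phi q - eps).
  by rewrite ler_norml; lra.
have [g hg] := choice lim.
exists g => [x|q].
  apply/(@cvgrPdist_le R R^o) => eps e0.
  have e20 : 0 < eps / 2 by rewrite divr_gt0.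
  have [d d0 hd] := hg x _ e20.
  apply/nbhs_ballP; exists d => // y; rewrite /ball /= distrC => xy.
  have [d' d'0 hd'] := hg y _ e20.
  have [q] : exists q : rat, `|ratr q - y| < Num.min d' (d - `|y - x|).
    by apply: rat_near; rewrite lt_min d'0 subr_gt0.
  rewrite lt_min => /andP[q1 q2].
  have h1 := hd' q q1.
  have h2 : `|phi q - g x| <= eps / 2.
    by apply: hd; have := ler_distD y (ratr q) x; lra.
  by have := ler_distD (phi q) (g x) (g y); rewrite (distrC (g x) (phi q)); lra.
apply/eqP; rewrite -subr_eq0 -normr_le0; apply/ler_addgt0Pr => eps e0; rewrite add0r.
have [d d0 hd] := hg (ratr q) _ e0.
by rewrite distrC; apply: hd; rewrite subrr normr0.
Qed.

(** * Dual directions, continuity and density *)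

(** Independence yields a nonzero 2 by 2 minor of [a] and [b]; Cramer's rule on its two coordinates
    gives [w]. *)
Lemma dual_direction (R : realType) (n : nat) (a b : 'rV[R]_n) :
  free [:: a; b] -> exists w, dotv a w = 1 /\ dotv b w = 0.
Proof.
rewrite free_cons seq1_free span_seq1 => /andP[ab /rV0Pn[q bq]].
have [/forallP h|] := boolP [forall p, a 0 p * b 0 q == a 0 q * b 0 p].
  case/negP: ab; apply/vlineP; exists (a 0 q / b 0 q); apply/rowP => p.
  by rewrite mxE mulrAC -(eqP (h p)) mulfK.
rewrite negb_forall => /existsP[p]; rewrite -subr_eq0 => c0.
exists ((a 0 p * b 0 q - a 0 q * b 0 p)^-1 *:
  (b 0 q *: delta_mx 0 p + - b 0 p *: delta_mx 0 q)).
rewrite !dotvZ !dotvD !dotvZ !dotv_delta; split; last first.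
  by rewrite mulNr mulrC (mulrC (b 0 q)) subrr mul0r.
by rewrite mulNr (mulrC (b 0 q)) (mulrC (b 0 p)) mulVf.
Qed.

Lemma sum_continuous (R : numFieldType) (V : normedModType R)
    (X : topologicalType) (I : Type) (r : seq I) (P : pred I) (F : I -> X -> V) :
  (forall i, P i -> continuous (F i)) ->
  continuous (fun x => \sum_(i <- r | P i) F i x).
Proof. exact: (@continuous_big V I +%R 0 P (@add_continuous V)). Qed.

Lemma dotv_continuous (R : realType) (n : nat) (a : 'rV[R]_n) : continuous (dotv a).
Proof.
apply: (@sum_continuous R R^o) => j _ x.
exact: (@cvgMl_tmp R _ _ (nbhs_filter x) (fun y : 'rV[R]_n => y 0 j) _ _
  (@coord_continuous R 1 n 0 j x)).
Qed.

Lemma mulmxr_continuous (R : realType) (m n : nat) (A : 'M[R]_(m, n)) :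
  continuous (fun y : 'rV[R]_m => y *m A).
Proof.
rewrite (_ : mulmx^~ A = fun z : 'rV[R]_m => \sum_i z 0 i *: row i A); last first.
  by apply/funext => z; rewrite mulmx_sum_row.
apply: (@sum_continuous R 'rV[R]_n) => i _ y.
apply: (@cvgZr_tmp R 'rV[R]_n _ _ (nbhs_filter y) (fun z : 'rV[R]_m => z 0 i)).
exact: (@coord_continuous R 1 m 0 i y).
Qed.

Lemma eq0_on_rational_vectors (R : realType) (n : nat) (h : 'rV[R]_n -> R) :
  continuous h -> (forall y, rational_vector y -> h y = 0) -> forall y, h y = 0.
Proof.
move=> ch h0 y; apply/eqP/negPn/negP => hy.
have e0 : 0 < `|h y| by rewrite normr_gt0.
have := @cvgrPdist_lt R R^o _ _ (nbhs_filter y) h (h y); case=> /(_ (@ch y)) /(_ _ e0) + _.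
move=> /nbhs_ballP[r r0 hr].
have [q hq] := choice (fun j => rat_near (y 0 j) r0).
have := hr (\row_j ratr (q j)); rewrite /= (h0 (\row_j _)) ?subr0 ?ltxx; last first.
  by move=> j; exists (q j); rewrite mxE.
suff yq : ball y r (\row_j ratr (q j)) by move/(_ yq).
by split=> // i j; rewrite mxE ord1 /ball /= distrC; exact: hq.
Qed.

(** * Extending the summands and transporting the identity by the adjoint of [T] *)

Theorem corollary4p1 (R : realType) (n k : nat) (a : 'I_k -> 'rV[R]_n)
    (ha : pairwise_independent a)
    (f : 'rV[R]_n -> R) (hf : continuous f)
    (fs : 'I_k -> R -> R)
    (hfs : forall x : 'rV[R]_n, f x = \sum_(i < k) fs i (dotv (a i) x))
    (T : {linear 'rV[R]_n -> 'rV[R]_n}) (hT : bijective T)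
    (hTa : forall i : 'I_k, rational_vector (T (a i))) :
  exists g : 'I_k -> R -> R,
    (forall i : 'I_k, continuous (g i)) /\
    (forall x : 'rV[R]_n, f x = \sum_(i < k) g i (dotv (a i) x)).
Proof.
have ext i : exists g : R -> R, continuous g /\
    forall x q, dotv (a i) x = ratr q -> g (ratr q) = fs i (ratr q).
  (* Independence permits a zero vector when [k = 1]. Then only the value at 0 matters, which is why
     [ext] asks for agreement only at attained rationals. *)
  have [ai0|/rV0Pn[p aip]] := eqVneq (a i) 0.
    exists (fun=> fs i 0); split=> [x|x q]; first exact: cvg_cst.
    by rewrite ai0 /dotv big1 => [<- //|j _]; rewrite mxE mul0r.
  have /choice[w hw] (j : 'I_k) : exists w, j != i -> dotv (a i) w = 1 /\ dotv (a j) w = 0.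
    have [->|ij] := eqVneq i j; first by exists 0.
    by have [w hw] := dual_direction (ha i j ij); exists w.
  have hu : dotv (a i) ((a i 0 p)^-1 *: delta_mx 0 p) = 1.
    by rewrite dotvZ dotv_delta mulVf.
  have := ridge_uniform_continuity hfs hu
    (fun j ji => (hw j ji).1) (fun j ji => (hw j ji).2) hf.
  by move=> /small_diffs_extension[g cg hg]; exists g.
have [g hg] := choice ext; exists g; split=> [i|]; first exact: (hg i).1.
pose A := lin1_mx T.
have TA v : T v = v *m A by rewrite mul_rV_lin1.
have Au : A \in unitmx.
  rewrite -row_free_unit -kermx_eq0; apply/rowV0P => v /sub_kermxP.
  by rewrite -TA => Tv; apply: (bij_inj hT); rewrite Tv linear0.
(* Through the adjoint, rational [y] give points [y *m A^T] whose products with all [a i] are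
   rational. *)
have adj i y : dotv (a i) (y *m A^T) = dotv (T (a i)) y.
  have dE (u v : 'rV[R]_n) : dotv u v = (u *m v^T) 0 0.
    by rewrite mxE; apply: eq_bigr => j _; rewrite mxE.
  by rewrite !dE trmx_mul trmxK mulmxA TA.
pose s x := \sum_(i < k) g i (dotv (a i) x); pose h x := f x - s x.
have cs : continuous s.
  apply: (@sum_continuous R R^o) => i _ x.
  apply: (@continuous_comp _ _ _ (dotv (a i)) (g i)); first exact: dotv_continuous.
  exact: (hg i).1.
have ch : continuous h.
  move=> x; exact: (@cvgB R R^o _ _ (nbhs_filter x) f s _ _ (@hf x) (@cs x)).
(* There [g i] agrees with [fs i], so [h] vanishes for rational [y], and by density for all [y]. *)
have h0 y : h (y *m A^T) = 0.
  apply: (@eq0_on_rational_vectors _ _ (fun y => h (y *m A^T))) y => [y|y ry].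
    exact: (continuous_comp (@mulmxr_continuous _ _ _ A^T y) (@ch _)).
  apply/eqP; rewrite subr_eq0 hfs; apply/eqP/eq_bigr => i _.
  have [q hq] : exists q : rat, dotv (a i) (y *m A^T) = ratr q.
    rewrite adj /dotv; elim/big_ind: _ => [|_ _ [p ->] [q ->]|j _].
    - by exists 0; rewrite rmorph0.
    - by exists (p + q); rewrite rmorphD.
    - have [p ->] := hTa i j; have [q ->] := ry j.
      by exists (p * q); rewrite rmorphM.
  by rewrite hq ((hg i).2 _ _ hq).
move=> x; apply/eqP; rewrite -subr_eq0; apply/eqP.
(* Invertibility of [A] makes every [x] of the form [y *m A^T]. *)
have := h0 (x *m invmx A^T); rewrite mulmxKV ?unitmx_tr //.
Qed.
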